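(* $f\mathcal{N}(\mathrm{Fin})\not\perp\mathcal{M}_-$, i.e. there are no $A\in f\mathcal{N}(\mathrm{Fin})$ and $B\in\mathcal{M}_-$ with $A\cup B=\omega^\omega$.
   Context: $\exists^\infty n$ means ''for infinitely many $n\in\omega$'', $\forall^\infty n$ means ''for all but finitely many $n\in\omega$''. A subset $F\subseteq\omega^\omega$ belongs to $f\mathcal{N}(\mathrm{Fin})$ if there is a sequence $(S_n)_{n\in\omega}$ of finite sets $S_n\subseteq\omega^n$ such that $F\subseteq\{x\in\omega^\omega:(\exists^\infty n)(x\upharpoonright n\in S_n)\}$. A set $F\subseteq\omega^\omega$ belongs to $\mathcal{M}_-$ if there are $x_F\in\omega^\omega$ and a partition $(I_n)_{n\in\omega}$ of $\omega$ into (nonempty, finite) intervals such that $F\subseteq\{x\in\omega^\omega:(\forall^\infty n)(x\upharpoonright I_n\neq x_F\upharpoonright I_n)\}$. Families $\mathcal{I},\mathcal{J}$ of subsets of $\omega^\omega$ are orthogonal, $\mathcal{I}\perp\mathcal{J}$, if there are $A\in\mathcal{I}$, $B\in\mathcal{J}$ with $A\cup B=\omega^\omega$. *)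

(* Defs.v *)
From mathcomp Require Import all_boot.
From mathcomp Require Import boolp classical_sets functions cardinality.

Set Implicit Arguments.
Unset Strict Implicit.
Unset Printing Implicit Defensive.

Local Open Scope classical_set_scope.

Local Notation baire := (nat -> nat).

(* [`I_n] is the set {0, ..., n-1}, i.e. the von Neumann ordinal n, and
   [sigL D x] is the restriction of [x] to [D], a function on the subtype of
   elements of [D]; hence [`I_n -> nat] is omega^n and [sigL `I_n x] is x|n. *)
Definition fN_Fin : set (set baire) := [set F |
  exists S : forall n, set (`I_n -> nat),
    (forall n, finite_set (S n)) /\
    F `<=` [set x | infinite_set [set n | S n (sigL `I_n x)]]].

(* Nonemptiness of the blocks is part of [partition]; the blocks need not be
   enumerated in increasing order. *)
Definition interval_partition (I : nat -> set nat) : Prop :=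
  partition setT I setT /\
  forall n, exists a b, I n = [set k | a <= k < b].

Definition M_minus : set (set baire) := [set F |
  exists (xF : baire) (I : nat -> set nat),
    interval_partition I /\
    F `<=` [set x | cofinite_set [set n | sigL (I n) x <> sigL (I n) xF]]].

Definition orthogonal (I J : set (set baire)) : Prop :=
  exists A B, [/\ I A, J B & A `|` B = setT].

(* Main.v *)
Require Import Defs.
From mathcomp Require Import all_boot.
From mathcomp Require Import boolp classical_sets functions cardinality.

Set Implicit Arguments.
Unset Strict Implicit.
Unset Printing Implicit Defensive.

Local Open Scope classical_set_scope.

(** Let [S] witness that a set is in [fN_Fin], and let [xF] and the interval
    partition [I] witness that a set is in [M_minus].  A point [x] outside both
    sets must leave [S] for good, although it agrees with [xF] on infinitely
    many blocks, where its values are prescribed.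

    The two demands are reconciled by copying [xF] on every other block only.
    If a block {a, ..., b - 1} is copied, then a > 0 and the position a - 1 is
    free, that is, not prescribed.  The sets S_n with a <= n <= b are finite in
    number and each is finite, so x(a - 1) can be chosen larger than the value
    at a - 1 of every member of every one of them; this keeps x|n out of S_n
    whenever a <= n <= b.  At a free position k which does not precede a copied
    block it suffices to do the same with S_{k+1}.
    Every n >= 1 is covered: if n - 1 is free, x(n - 1) settles n; otherwise
    n - 1 lies in a copied block and the free position just before that block
    settles n.

    [alternating_blocks] selects the copied blocks, [coordinate_bound] supplies
    the large values, and [exists_avoiding_matching] builds [x]. *)

Lemma finite_nat_bounded (A : set nat) :
  finite_set A -> exists m, forall k, A k -> k <= m.
Proof.
move=> /finite_seqP[s ->]; exists (\max_(k <- s) k) => k /= ks.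
exact: (leq_bigmax_seq (F := id)).
Qed.

(** The bound is a function on all of [nat], so that the proofs of membership
    carried by the domain [D] do not appear when it is used. *)
Lemma coordinate_bound (D : set nat) (S : set (D -> nat)) :
  finite_set S ->
  exists h : nat -> nat, forall y, S (sigL D y) -> forall k, D k -> y k <= h k.
Proof.
move=> finS.
have /choice[g gP] (i : D) : exists m, forall s, S s -> s i <= m.
  have [m mP] := finite_nat_bounded (finite_image (fun s => s i) finS).
  by exists m => s Ss; apply: mP; exists s.
have [h _ hg] : range (sigL D) g by rewrite (image_sigL 0).
exists h => y Sy k Dk.
by have := gP (SigSub (mem_set Dk)) _ Sy; rewrite -hg.
Qed.

(** The blocks need not be listed in increasing order, so a block is handled
    through the index [e k] of the block that contains [k]; [z n] is the right
    end of the block of index [n]. *)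
Lemma block_index (I : nat -> set nat) : interval_partition I ->
  exists e z : nat -> nat,
    [/\ forall n k, I n k <-> e k = n,
        forall k l, k <= l -> e k = e l -> forall i, k <= i <= l -> e i = e k
      & forall k, k < z (e k)].
Proof.
move=> [[covI trivI _] intI].
have /choice[e eP] (k : nat) : exists n, I n k.
  have : cover setT I k by rewrite covI.
  by move=> [n _ Ink]; exists n.
have /choice[a /choice[z azP]] := intI.
have eI n k : I n k <-> e k = n.
  split=> [Ink|<-//]; apply: trivI => //.
  by exists k.
exists e, z; split=> // [k l kl ekl i /andP[ki il]|k].
  apply/eI; have := eP k; have := eP l; rewrite -ekl azP /=.
  move=> /andP[_ lz] /andP[ak _].
  by rewrite (leq_trans ak ki) (leq_ltn_trans il lz).
by have := eP k; rewrite azP => /andP[].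
Qed.

(** Two colours alternate along the blocks, the block of [0] getting [false].
    [N m] is the right end of the block of [m.+1]; hence, in the last clause,
    [m] can be the position just before the block of [k]. *)
Lemma alternating_blocks (I : nat -> set nat) : interval_partition I ->
  exists (p : nat -> bool) (N : nat -> nat),
    [/\ forall n k l, I n k -> I n l -> p k = p l,
        forall K, exists2 k, K <= k & p k,
        forall m, m < N m
      & forall k, p k -> exists m, [/\ m < k, ~~ p m & k < N m]].
Proof.
move=> /block_index[e [z [eI eint ez]]].
pose p := fix p k := if k is j.+1 then
  if e j.+1 == e j then p j else ~~ p j else false.
have pS k : p k.+1 = if e k.+1 == e k then p k else ~~ p k by [].
have pblock k d : e (k + d) = e k -> p (k + d) = p k.
  elim: d => [|d IHd]; rewrite ?addn0// addnS => ekd.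
  have ekd' : e (k + d) = e k.
    apply: (eint k (k + d).+1) => //; last by rewrite leq_addr leqnSn.
    by rewrite -addnS leq_addr.
  by rewrite pS ekd ekd' eqxx IHd.
exists p, (fun m => z (e m.+1)); split.
- move=> n k l /eI ek /eI el.
  case: (leqP k l) => [kl|/ltnW lk].
    by have := pblock k (l - k); rewrite subnKC// ek el => ->.
  by have := pblock l (k - l); rewrite subnKC// ek el => ->.
- (* If [p] were [false] from [K] on, the block of [K] would be unbounded. *)
  move=> K; apply: contrapT => noK.
  have pF k : K <= k -> p k = false.
    by move=> Kk; apply/negbTE/negP => pk; apply: noK; exists k.
  have eK d : e (K + d) = e K.
    elim: d => [|d IHd]; rewrite ?addn0// addnS.
    have := pS (K + d); rewrite !pF ?leq_addr//; last first.
      by rewrite -addnS leq_addr.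
    by case: eqP => // ->.
  by have := ez (K + z (e K)); rewrite eK ltnNge leq_addl.
- by move=> m; apply: ltn_trans (ez _).
- (* The witness is the last position of the preceding block. *)
  move=> k pk.
  suff [m [mk pm em]] : exists m, [/\ m < k, ~~ p m & e m.+1 = e k].
    by exists m; rewrite em.
  elim: k pk => [//|k IHk]; rewrite pS; case: eqP => [-> pk|_ pk].
    by have [m [mk pm em]] := IHk pk; exists m; split=> //; exact: ltnW.
  by exists k.
Qed.

Lemma exists_avoiding_matching (S : forall n, set (`I_n -> nat))
    (xF : nat -> nat) (I : nat -> set nat) :
  (forall n, finite_set (S n)) -> interval_partition I ->
  exists x : nat -> nat,
    (forall n, 0 < n -> ~ S n (sigL `I_n x)) /\
    infinite_set [set n | sigL (I n) x = sigL (I n) xF].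
Proof.
move=> finS partI.
have [p [N [pI pinf ltN pprev]]] := alternating_blocks partI.
have /choice[h hP] n := coordinate_bound (finS n).
pose M k := (\max_(n < (N k).+1) h n k).+1.
pose x k := if p k then xF k else M k.
have free_avoids m n : ~~ p m -> m < n -> n <= N m -> ~ S n (sigL `I_n x).
  move=> /negbTE pm mn nN /hP /(_ m mn); rewrite /x pm /M leqNgt => /negP; apply.
  have nN1 : n < (N m).+1 by [].
  by rewrite ltnS (leq_bigmax (F := fun i : 'I__ => h i m) (Ordinal nN1)).
exists x; split=> [[//|n] _|finA].
  have [pn|pn] := boolP (p n); last exact: free_avoids pn _ (ltN n).
  have [m [mn pm nN]] := pprev n pn.
  by apply: free_avoids pm _ nN; exact: ltnW.
have [[covI _ _] intI] := partI.
(* The union of finitely many agreeing blocks would be bounded, yet it contains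
   every position of colour [true]. *)
set U := \bigcup_(n in [set n | sigL (I n) x = sigL (I n) xF]) I n.
have finU : finite_set U.
  apply: bigcup_finite => // n _; have [a [b ->]] := intI n.
  by apply: sub_finite_set (finite_II b) => k /= /andP[].
have [m mP] := finite_nat_bounded finU.
have [k mk pk] := pinf m.+1.
have : cover setT I k by rewrite covI.
move=> [n _ Ink]; have /mP : U k.
  exists n => //=; apply/eq_sigLP => i /set_mem Ini.
  by rewrite /x (pI n i k Ini Ink) pk.
by rewrite leqNgt mk.
Qed.

Theorem theorem41 : ~ orthogonal fN_Fin M_minus.
Proof.
move=> [A [B [[S [finS AS]] [xF [I [partI BI]]] AB]]].
have [x [xS xI]] := exists_avoiding_matching xF finS partI.
have : (A `|` B) x by rewrite AB.
move=> [/AS/=|/BI/=].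
  apply; apply: sub_finite_set (finite_II 1) => n /= Sn.
  by rewrite ltnS leqn0; apply: contrapT => /negP; rewrite -lt0n => /xS.
by apply: contra_not xI; apply: sub_finite_set => n /= ? ?.
Qed.
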